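(* If a reduced $(2K_2,K_4,B_{10})$-free graph $G$ contains an induced copy of $B_{11}$, then $\mathcal{R}_5(G)$ is connected.
   Context: All graphs are finite and simple. $2K_2$ is the disjoint union of two edges (four vertices), and $K_4$ is the complete graph on four vertices. A graph is $(F_1,\dots,F_k)$-free if it contains no induced subgraph isomorphic to any $F_i$. Containing an induced copy of $B_{11}$ means having an induced subgraph isomorphic to $B_{11}$. Distinct vertices $u,v$ of $G$ are comparable if $N_G(u)\subseteq N_G(v)$ or $N_G(v)\subseteq N_G(u)$, where $N_G$ denotes the open neighborhood. A graph is reduced if it contains no pair of comparable vertices. The reconfiguration graph $\mathcal{R}_5(G)$ has as its vertices the proper $5$-colorings of $G$ (assignments to each vertex of one of $5$ fixed colors such that adjacent vertices receive distinct colors; not all colors need be used), two colorings being adjacent if they differ on exactly one vertex of $G$. Write $C=\{c_1,\dots,c_5\}$. The graph $B_{10}$ has vertex set $\{c_1,c_2,c_3,c_4,c_5,f,a,g,y,r\}$. Its edges are: the $5$-cycle edges $c_1c_2,c_2c_3,c_3c_4,c_4c_5,c_5c_1$; the edges given by $N(f)\cap C=\{c_2,c_3,c_4,c_5\}$, $N(a)\cap C=\{c_1,c_3,c_4\}$, $N(g)\cap C=\{c_1,c_3,c_4,c_5\}$, $N(y)\cap C=\{c_1,c_3,c_5\}$, $N(r)\cap C=\{c_2,c_5\}$; and the edges $yf,ya,rf,ra,rg$. There are no other edges. The graph $B_{11}$ has vertex set $\{c_1,c_2,c_3,c_4,c_5,f,a,g,x,b,q\}$. Its edges are: the $5$-cycle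 edges $c_1c_2,c_2c_3,c_3c_4,c_4c_5,c_5c_1$; the edges given by $N(f)\cap C=\{c_2,c_3,c_4,c_5\}$, $N(a)\cap C=\{c_1,c_3,c_4\}$, $N(g)\cap C=\{c_1,c_3,c_4,c_5\}$, $N(x)\cap C=\{c_2,c_4,c_5\}$, $N(b)\cap C=\{c_2,c_3,c_5\}$, $N(q)\cap C=\{c_1,c_3\}$; and the edges $xa,ba,bg,qf,qa,qg,qx$. There are no other edges. *)

(* Defs.v *)
From mathcomp Require Import all_boot.

Set Implicit Arguments.
Unset Strict Implicit.
Unset Printing Implicit Defensive.

Record sgraph := SGraph {
  svertex :> finType;
  sedge : rel svertex;
  sedge_sym : symmetric sedge;
  sedge_irrefl : irreflexive sedge }.

Arguments sedge {s} : rename.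

Section GraphNotions.

Variable G : sgraph.

Definition nbhd (v : G) : {set G} := [set w | sedge v w].

Definition comparable_vertices (u v : G) : bool :=
  (u != v) && ((nbhd u \subset nbhd v) || (nbhd v \subset nbhd u)).

Definition reduced : Prop := forall u v : G, ~~ comparable_vertices u v.

(* The null graph is not regarded as connected. *)
Definition connected_graph : Prop :=
  0 < #|G| /\ forall u v : G, connect (@sedge G) u v.

End GraphNotions.

Definition contains_induced (F G : sgraph) : Prop :=
  exists f : F -> G, injective f /\ forall x y, sedge (f x) (f y) = sedge x y.

Definition graph_free (F G : sgraph) : Prop := ~ contains_induced F G.

Section Reconfiguration.

Variables (k : nat) (G : sgraph).

Definition proper_coloring (c : {ffun G -> 'I_k}) : bool :=
  [forall u, forall v, sedge u v ==> (c u != c v)].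

Definition coloring : finType := {c : {ffun G -> 'I_k} | proper_coloring c}.

Definition reconf_adj (c d : coloring) : bool :=
  #|[set v | val c v != val d v]| == 1.

Lemma reconf_adj_sym : symmetric reconf_adj.
Proof.
move=> c d; rewrite /reconf_adj; congr (#|pred_of_set _| == 1).
by apply/setP=> v; rewrite !inE eq_sym.
Qed.

Lemma reconf_adj_irrefl : irreflexive reconf_adj.
Proof.
move=> c; rewrite /reconf_adj (_ : [set v | _] = set0) ?cards0 //.
by apply/setP=> v; rewrite !inE eqxx.
Qed.

Definition reconf_graph : sgraph := SGraph reconf_adj_sym reconf_adj_irrefl.

End Reconfiguration.

Section GraphOfEdges.

Variables (n : nat) (E : seq (nat * nat)).

(* Each undirected edge is listed once, in either orientation. *)
Definition edges_rel (i j : 'I_n) : bool :=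
  (i != j) &&
  (((i : nat, j : nat) \in E) || ((j : nat, i : nat) \in E)).

Lemma edges_rel_sym : symmetric edges_rel.
Proof. by move=> i j; rewrite /edges_rel eq_sym orbC. Qed.

Lemma edges_rel_irrefl : irreflexive edges_rel.
Proof. by move=> i; rewrite /edges_rel eqxx. Qed.

Definition graph_of_edges : sgraph := SGraph edges_rel_sym edges_rel_irrefl.

End GraphOfEdges.

Section CompleteGraph.

Variable n : nat.

Definition complete_rel (i j : 'I_n) : bool := i != j.

Lemma complete_rel_sym : symmetric complete_rel.
Proof. by move=> i j; rewrite /complete_rel eq_sym. Qed.

Lemma complete_rel_irrefl : irreflexive complete_rel.
Proof. by move=> i; rewrite /complete_rel eqxx. Qed.

Definition complete_graph : sgraph :=
  SGraph complete_rel_sym complete_rel_irrefl.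

End CompleteGraph.

Definition K4 : sgraph := complete_graph 4.

Definition two_K2 : sgraph := graph_of_edges 4 [:: (0, 1); (2, 3)].

Definition star_edges (v : nat) (s : seq nat) : seq (nat * nat) :=
  [seq (v, w) | w <- s].

Definition B10_edges : seq (nat * nat) :=
  let c1 := 0 in let c2 := 1 in let c3 := 2 in let c4 := 3 in let c5 := 4 in
  let f := 5 in let a := 6 in let g := 7 in let y := 8 in let r := 9 in
  [:: (c1, c2); (c2, c3); (c3, c4); (c4, c5); (c5, c1)]
  ++ star_edges f [:: c2; c3; c4; c5]
  ++ star_edges a [:: c1; c3; c4]
  ++ star_edges g [:: c1; c3; c4; c5]
  ++ star_edges y [:: c1; c3; c5]
  ++ star_edges r [:: c2; c5]
  ++ [:: (y, f); (y, a); (r, f); (r, a); (r, g)].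

Definition B10 : sgraph := graph_of_edges 10 B10_edges.

Definition B11_edges : seq (nat * nat) :=
  let c1 := 0 in let c2 := 1 in let c3 := 2 in let c4 := 3 in let c5 := 4 in
  let f := 5 in let a := 6 in let g := 7 in
  let x := 8 in let b := 9 in let q := 10 in
  [:: (c1, c2); (c2, c3); (c3, c4); (c4, c5); (c5, c1)]
  ++ star_edges f [:: c2; c3; c4; c5]
  ++ star_edges a [:: c1; c3; c4]
  ++ star_edges g [:: c1; c3; c4; c5]
  ++ star_edges x [:: c2; c4; c5]
  ++ star_edges b [:: c2; c3; c5]
  ++ star_edges q [:: c1; c3]
  ++ [:: (x, a); (b, a); (b, g); (q, f); (q, a); (q, g); (q, x)].

Definition B11 : sgraph := graph_of_edges 11 B11_edges.

(* Main.v *)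
Require Import Defs.
From mathcomp Require Import all_boot.

Set Implicit Arguments.
Unset Strict Implicit.
Unset Printing Implicit Defensive.

(** Why the theorem holds.  Fix an induced copy of B11 in [G], and call the set
    of its vertices adjacent to a vertex [v] the trace of [v].

    Rigidity.  In a graph without induced 2K2, K4 and B10, the trace of any
    vertex is either empty or the trace of a vertex of the copy
    ([trace_in_traces]); this is a search through the 2048 conceivable traces.
    Any two of these twelve admissible traces differ in at least two places
    ([traces_separated]).  So, if [v] has the trace of the copy's vertex [x],
    replace [x] by [v] in the copy: the trace of any other vertex [w] is
    admissible before and after and can change at one place only, hence it does
    not change, and [w] sees [v] if and only if it sees [x].  Thus [v] and [x]
    have the same neighbors, and [v] is [x] because [G] is reduced
    ([copy_vertex]).  A vertex with empty trace is isolated, which a reduced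
    graph forbids as well.  Therefore [G] is B11 itself ([copy_onto]).

    Reconfiguration of B11.  There is a synchronizing sequence of twelve moves
    of the form: give [v] the color of [w], or in one move a color that does not
    occur, unless a neighbor of [v] has it already.  It takes every one of the 28200 proper 5-colorings of B11 to a coloring with
    one and the same partition into four color classes ([word_resets]).
    It remains to connect two colorings that have the same classes.  As they
    leave a color unused, the classes can be recolored one at a time, the free
    color being used to unlock cycles ([reach_same_classes]). *)

(** * Induced copies and twins *)

Definition edge_preserving (F G : sgraph) (f : F -> G) : Prop :=
  forall x y, sedge (f x) (f y) = sedge x y.

Definition twin_free (F : sgraph) : Prop :=
  forall x y : F, nbhd x = nbhd y -> x = y.

(** Vertices with the same image have the same neighbors. *)
Lemma induced_of_twin_free (F G : sgraph) (f : F -> G) :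
  twin_free F -> edge_preserving f -> injective f.
Proof.
move=> twF fE x y fxy; apply: twF; apply/setP=> z.
by rewrite !inE -!fE fxy.
Qed.

Lemma reduced_sub (G : sgraph) (u v : G) :
  reduced G -> nbhd u \subset nbhd v -> u = v.
Proof.
move=> redG uv; apply/eqP/negPn/negP=> ne_uv.
by have := redG u v; rewrite /comparable_vertices ne_uv uv.
Qed.

Lemma reduced_twin_free (G : sgraph) : reduced G -> twin_free G.
Proof. by move=> redG u v uv; apply: reduced_sub => //; rewrite uv. Qed.

(** * Reconfiguration in an arbitrary graph *)

Section Reconfigure.

Variables (k : nat) (G : sgraph).
Implicit Types c d : coloring k G.

Local Notation reach := (connect (@reconf_adj k G)).

Lemma reach_sym c d : reach c d = reach d c.
Proof. exact/sym_connect_sym/reconf_adj_sym. Qed.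

Lemma coloringP c u v : sedge u v -> val c u != val c v.
Proof. by move=> uv; have /forallP/(_ u)/forallP/(_ v)/implyP-> := valP c. Qed.

Lemma coloring_exists (g : G -> 'I_k) :
  (forall u v, sedge u v -> g u != g v) ->
  exists d : coloring k G, forall u, val d u = g u.
Proof.
move=> g_ok.
have gP : proper_coloring [ffun u => g u].
  by apply/forallP=> u; apply/forallP=> v; apply/implyP=> uv; rewrite !ffunE g_ok.
by exists (Sub _ gP) => u; rewrite SubK ffunE.
Qed.

Lemma recolor c (v : G) (a : 'I_k) :
  (forall u, sedge v u -> val c u != a) ->
  exists2 d, reach c d & forall u, val d u = if u == v then a else val c u.
Proof.
move=> a_ok.
have [|d dE] := @coloring_exists (fun u => if u == v then a else val c u).
  move=> x y; have [-> | _] := eqVneq x v; have [-> | _] := eqVneq y v => xy.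
  - by rewrite sedge_irrefl in xy.
  - by rewrite eq_sym a_ok.
  - by rewrite a_ok // sedge_sym.
  - exact: coloringP.
exists d => //.
have [av | nav] := eqVneq (val c v) a.
  suff -> : c = d by apply: connect0.
  by apply/val_inj/ffunP=> u; rewrite dE; have [->|] := eqVneq u v.
apply: connect1; rewrite /reconf_adj (_ : [set _ | _] = [set v]) ?cards1 //.
by apply/setP=> u; rewrite !inE dE; have [->|] := eqVneq u v; rewrite ?eqxx.
Qed.

(** The hypothesis makes every mixture of [c] and [d] proper, so the vertices
    can be moved from [c] to [d] one at a time, in any order. *)
Lemma reach_mix c d :
  (forall u v, sedge u v -> val c u != val d v) -> reach c d.
Proof.
have [n] := ubnP #|[set v | val c v != val d v]|; elim: n c => // n IHn c.
move=> lt_n mix.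
have [v ne_v | eq_cd] := pickP (fun v => val c v != val d v); last first.
  suff -> : c = d by apply: connect0.
  by apply/val_inj/ffunP=> v; apply/eqP; have := eq_cd v; case: eqP.
have [|c' cc' c'E] := @recolor c v (val d v).
  by move=> u vu; apply: mix; rewrite sedge_sym.
apply: connect_trans cc' (IHn c' _ _); last first.
  move=> x y; rewrite c'E; have [-> | _] := eqVneq x v; last exact: mix.
  exact: coloringP.
rewrite -ltnS; apply: leq_trans lt_n; rewrite ltnS; apply: proper_card.
apply/properP; split.
  apply/subsetP=> u; rewrite !inE c'E; have [-> | //] := eqVneq u v.
  by rewrite eqxx.
by exists v; rewrite !inE ?c'E ?eqxx.
Qed.

(** By [reach_mix]: the two colorings agree outside one independent class,
    whose new color occurs nowhere else. *)
Lemma recolor_class c (a b : 'I_k) :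
  (forall u, val c u != b) ->
  exists d, [/\ reach c d,
    forall u, val d u = if val c u == a then b else val c u &
    forall u v, (val d u == val d v) = (val c u == val c v)].
Proof.
move=> b_free; pose g u := if val c u == a then b else val c u.
have same u v : (g u == g v) = (val c u == val c v).
  rewrite /g; case: (val c u =P a) => [->|/eqP cu];
    case: (val c v =P a) => [->|/eqP cv]; rewrite ?eqxx //.
  - by rewrite eq_sym (negPf (b_free v)) eq_sym (negPf cv).
  - by rewrite (negPf (b_free u)) (negPf cu).
have [|d dE] := @coloring_exists g.
  by move=> u v uv; rewrite same coloringP.
exists d; split=> //; last by move=> u v; rewrite !dE same.
apply: reach_mix => u v uv; rewrite dE /g.
by case: ifP => _; [apply: b_free | apply: coloringP].
Qed.

(** Move the classes of [c] onto the colors given by [d]: a class whose target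
    color is unused can go there directly, and a class that occupies the
    target of another one is first parked on the missing color. *)
Lemma reach_same_classes c d (e : 'I_k) :
    (forall u v, (val c u == val c v) = (val d u == val d v)) ->
    (forall u, val c u != e) ->
  reach c d.
Proof.
have [n] := ubnP #|[set v | val c v != val d v]|; elim: n c e => // n IHn c e.
move=> lt_n same e_free.
have [v ne_v | eq_cd] := pickP (fun v => val c v != val d v); last first.
  suff -> : c = d by apply: connect0.
  by apply/val_inj/ffunP=> v; apply/eqP; have := eq_cd v; case: eqP.
(* Once the color [d v] is unused, the class of [v] moves there, which strictly
   decreases the number of vertices where [c] and [d] differ; the color given
   up becomes the new missing color. *)
have settle c1 : #|[set v | val c1 v != val d v]| < n.+1 ->
    (forall u w, (val c1 u == val c1 w) = (val d u == val d w)) ->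
    val c1 v != val d v -> (forall u, val c1 u != val d v) -> reach c1 d.
  move=> lt_n1 same1 ne1_v free1.
  have [c2 [c12 c2E same2]] := @recolor_class c1 (val c1 v) (val d v) free1.
  apply: connect_trans c12 (IHn c2 (val c1 v) _ _ _).
  - rewrite -ltnS; apply: leq_trans lt_n1; rewrite ltnS; apply: proper_card.
    apply/properP; split; last by exists v; rewrite !inE ?c2E ?eqxx.
    apply/subsetP=> u; rewrite !inE c2E same1.
    by have [->|] := eqVneq (val d u) (val d v); rewrite ?eqxx.
  - by move=> u w; rewrite same2 same1.
  - move=> u; rewrite c2E; case: ifP => [_ | -> //].
    by rewrite eq_sym.
have [w cw | free] := pickP (fun w => val c w == val d v); last first.
  by apply: settle => // u; rewrite free.
have [c1 [cc1 c1E same1]] := @recolor_class c (val d v) e e_free.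
apply: connect_trans cc1 (settle c1 _ _ _ _).
(* Parking creates no disagreement: a vertex [u] with [c u = d v] and
   [c u = d u] would lie in the class of [v], but [c v <> d v]. *)
- apply: leq_ltn_trans lt_n; apply/subset_leq_card/subsetP=> u.
  rewrite !inE c1E; have [cu _ | //] := eqVneq (val c u) (val d v).
  apply/negP=> /eqP dvu; have := same u v.
  by rewrite -dvu cu eqxx eq_sym (negPf ne_v).
- by move=> x y; rewrite same1 same.
- by rewrite c1E (negPf ne_v).
- move=> u; rewrite c1E; case: ifP => [_ | -> //].
  by rewrite eq_sym -(eqP cw) e_free.
Qed.

End Reconfigure.

(** * Exhaustive search over words *)

(** Whether [P] holds of all extensions of [s] by [n] letters of [A] along which
    every prefix is [good].  The test is an [if], because a boolean implication
    would be evaluated strictly and the bad branches would not be cut. *)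
Fixpoint all_words (T : Type) (A : seq T) (good : pred (seq T)) (n : nat)
    (s : seq T) (P : pred (seq T)) : bool :=
  if n is n'.+1 then
    all (fun a => if good (rcons s a) then all_words A good n' (rcons s a) P
                  else true) A
  else P s.

Lemma all_wordsP (T : eqType) (A : seq T) (good P : pred (seq T)) (w s : seq T) :
    all_words A good (size w) s P ->
    {subset w <= A} -> (forall i, good (s ++ take i.+1 w)) ->
  P (s ++ w).
Proof.
elim: w s => [|a w IHw] s /=; first by rewrite cats0.
move=> /allP all_s w_A w_good; rewrite -cat_rcons; apply: IHw.
- apply: (implyP (all_s a (w_A _ (mem_head _ _)))).
  by rewrite -cats1 -(take0 w); apply: (w_good 0).
- by move=> b bw; apply: w_A; rewrite inE bw orbT.
- by move=> i; rewrite cat_rcons; apply: (w_good i.+1).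
Qed.

(** * Graphs given by a list of edges *)

Definition erel (E : seq (nat * nat)) (i j : nat) : bool :=
  (i != j) && (((i, j) \in E) || ((j, i) \in E)).

Definition twin_free_edges (n : nat) (E : seq (nat * nat)) : bool :=
  all (fun i => all (fun j => (i == j) ||
    has (fun l => erel E i l != erel E j l) (iota 0 n)) (iota 0 n)) (iota 0 n).

Lemma twin_free_edgesP (n : nat) (E : seq (nat * nat)) :
  twin_free_edges n E -> twin_free (graph_of_edges n E).
Proof.
move=> /allP tab x y /setP xy.
have ordI (z : 'I_n) : nat_of_ord z \in iota 0 n by rewrite mem_iota /=.
have /allP/(_ _ (ordI y)) := tab _ (ordI x).
case/orP=> [/eqP/val_inj // | /hasP[l]]; rewrite mem_iota /= => lt_l.
case/eqP; have := xy (Ordinal lt_l); rewrite !inE /= /edges_rel -!val_eqE.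
exact.
Qed.

(** * The graph B11 as a table *)

Definition B11_nbrs : seq (seq nat) :=
  [:: [:: 1; 4; 6; 7; 10];
      [:: 0; 2; 5; 8; 9];
      [:: 1; 3; 5; 6; 7; 9; 10];
      [:: 2; 4; 5; 6; 7; 8];
      [:: 0; 3; 5; 7; 8; 9];
      [:: 1; 2; 3; 4; 10];
      [:: 0; 2; 3; 8; 9; 10];
      [:: 0; 2; 3; 4; 9; 10];
      [:: 1; 3; 4; 6; 10];
      [:: 1; 2; 4; 6; 7];
      [:: 0; 2; 5; 6; 7; 8]].

Lemma B11_nbrsE (x y : B11) :
  sedge x y = (nat_of_ord y \in nth [::] B11_nbrs x).
Proof.
have /allP tab : all (fun i => all (fun j =>
    erel B11_edges i j == (j \in nth [::] B11_nbrs i)) (iota 0 11)) (iota 0 11).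
  by vm_compute.
have ordI (z : 'I_11) : nat_of_ord z \in iota 0 11 by rewrite mem_iota /=.
by have /allP/(_ _ (ordI y))/eqP := tab _ (ordI x).
Qed.

(** * Colorings of B11 *)

Local Notation coloring11 := (coloring 5 B11).
Local Notation reach := (connect (@reconf_adj 5 B11)).

Definition colors (c : coloring11) : seq nat :=
  [seq nat_of_ord (val c v) | v <- enum 'I_11].

Lemma size_colors (c : coloring11) : size (colors c) = 11.
Proof. by rewrite size_map size_enum_ord. Qed.

Lemma nth_colors (c : coloring11) (v : 'I_11) : nth 0 (colors c) v = val c v.
Proof. by rewrite (nth_map v) ?size_enum_ord // nth_ord_enum. Qed.

Lemma colorsP (c : coloring11) a :
  reflect (exists v, a = val c v :> nat) (a \in colors c).
Proof.
apply: (iffP mapP) => [[v _ ->] | [v ->]]; exists v => //.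
by rewrite mem_enum.
Qed.

(** A move [(v, Some w)] gives [v] the color of [w]; a move [(v, None)] gives it
    the first of the five colors that does not occur, if there is one.  Since
    colors are referred to by vertices, moves act on partitions into color
    classes, and 235 partitions are to be merged instead of 28200 colorings. *)
Definition move_color (s : seq nat) (m : nat * option nat) : nat :=
  if m.2 is Some w then nth 0 s w
  else head (nth 0 s m.1) [seq a <- iota 0 5 | a \notin s].

Definition apply_move (s : seq nat) (m : nat * option nat) : seq nat :=
  let a := move_color s m in
  if all (fun u => nth 0 s u != a) (nth [::] B11_nbrs m.1)
  then set_nth 0 s m.1 a else s.

(** Found by a beam search over sets of partitions: the first six moves take the
    235 partitions to 11, and all the moves to a single one.  Copying colors
    alone cannot do this: it keeps four classes four, and it leaves the nine
    partitions into four classes in two components. *)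
Definition word : seq (nat * option nat) :=
  [:: (0, Some 8); (10, Some 3); (5, Some 8); (6, Some 4); (1, Some 6);
      (9, Some 3); (7, None); (4, Some 1); (0, Some 2); (7, Some 5);
      (10, Some 3); (8, Some 5)].

(** Properness at the last vertex only, the earlier ones having been tested when
    they were added. *)
Definition proper_prefix (s : seq nat) : bool :=
  let v := (size s).-1 in
  all (fun u => if u < v then nth 0 s u != nth 0 s v else true)
    (nth [::] B11_nbrs v).

(** A color is replaced by the first place where it occurs, so that the pattern
    determines the partition into color classes and forgets the colors. *)
Definition pattern (s : seq nat) : seq nat := [seq index a s | a <- s].

(** The partition with classes [c1 c3], [c2 c5 a], [c4 b q], [f g x], in the
    order [c1, ..., c5, f, a, g, x, b, q], with one of the five colors unused. *)
Definition normal (s : seq nat) :=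
  (pattern s == [:: 0; 1; 0; 3; 1; 5; 1; 5; 5; 3; 3]) &&
  has (fun a => a \notin s) (iota 0 5).

Lemma word_resets :
  all_words (iota 0 5) proper_prefix 11 [::]
    (fun s => normal (foldl apply_move s word)).
Proof. by vm_compute. Qed.

(** The color of a move is below 5 even when [v] has no fresh color available. *)
Lemma move_colorE (c : coloring11) m :
    m.1 < 11 -> (if m.2 is Some w then w < 11 else true) ->
  exists a : 'I_5, move_color (colors c) m = a.
Proof.
move=> lt_v; rewrite /move_color; case: m.2 => [w | _] => [lt_w |].
  by exists (val c (Ordinal lt_w)); apply: (nth_colors c (Ordinal lt_w)).
set free := [seq a <- iota 0 5 | a \notin colors c].
have free5 : {subset free <= iota 0 5} by move=> a; rewrite mem_filter => /andP[].
case: free free5 => [|a s] free5.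
  by exists (val c (Ordinal lt_v)); apply: (nth_colors c (Ordinal lt_v)).
have := free5 a (mem_head _ _); rewrite mem_iota => lt_a.
by exists (Ordinal lt_a).
Qed.

Lemma apply_move_reach (c : coloring11) m :
    m.1 < 11 -> (if m.2 is Some w then w < 11 else true) ->
  exists2 d, reach c d & colors d = apply_move (colors c) m.
Proof.
move=> lt_v src_ok; have [a aE] := move_colorE c lt_v src_ok.
rewrite /apply_move aE; case: allP => [free | _]; last first.
  by exists c => //; apply: connect0.
have [|d cd dE] := @recolor _ _ c (Ordinal lt_v) a.
  by move=> u; rewrite B11_nbrsE => /free; rewrite nth_colors.
exists d => //; apply: (@eq_from_nth _ 0).
  by rewrite size_set_nth !size_colors; apply/esym/maxn_idPr.
move=> i; rewrite size_colors => lt_i; rewrite nth_set_nth /=.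
rewrite -[i]/(nat_of_ord (Ordinal lt_i)) !nth_colors dE.
by rewrite -val_eqE /=; case: ifP.
Qed.

Lemma word_reach (c : coloring11) :
  exists2 d, reach c d & colors d = foldl apply_move (colors c) word.
Proof.
have : all (fun m => (m.1 < 11) && (if m.2 is Some w then w < 11 else true)) word.
  by [].
elim: word c => [|m s IHs] c /=; first by exists c => //; apply: connect0.
case/andP=> /andP[m1 m2] /IHs{}IHs.
have [d cd <-] := apply_move_reach c m1 m2.
by have [e de eE] := IHs d; exists e => //; apply: connect_trans de.
Qed.

Lemma colors_normal (c : coloring11) : normal (foldl apply_move (colors c) word).
Proof.
apply: (@all_wordsP _ (iota 0 5) proper_prefix
  (fun s => normal (foldl apply_move s word)) (colors c) [::]).
- by rewrite size_colors word_resets.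
- by move=> a /colorsP[v ->]; rewrite mem_iota /=.
move=> i; rewrite /proper_prefix size_take size_colors.
set v := (if _ then _ else _).-1.
have [lt_v le_vi] : v < 11 /\ v <= i.
  rewrite /v; have [lt_i | le_i] := ltnP i.+1 11; split=> //.
  exact: ltnW.
apply/allP=> u vu; case: ifP => // lt_uv.
have lt_u := ltn_trans lt_uv lt_v.
rewrite !nth_take ?ltnS // ?(leq_trans (ltnW lt_uv)) //.
rewrite -[u]/(nat_of_ord (Ordinal lt_u)) -[v]/(nat_of_ord (Ordinal lt_v)).
rewrite !nth_colors eq_sym; apply: coloringP.
by rewrite B11_nbrsE.
Qed.

Lemma pattern_same_classes (s t : seq nat) i j :
    size s = size t -> pattern s = pattern t -> i < size s -> j < size s ->
  (nth 0 s i == nth 0 s j) = (nth 0 t i == nth 0 t j).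
Proof.
move=> st pat lt_i lt_j.
have index_eq (r : seq nat) k l : k < size r -> l < size r ->
    (nth 0 r k == nth 0 r l) = (nth 0 (pattern r) k == nth 0 (pattern r) l).
  move=> lt_k lt_l; rewrite !(nth_map 0) //.
  apply/eqP/eqP=> [-> // | kl].
  rewrite -[LHS](nth_index 0 (mem_nth 0 lt_k)) kl.
  by rewrite nth_index // mem_nth.
by rewrite index_eq // pat -index_eq -?st.
Qed.

Lemma reconf_B11_connected : connected_graph (reconf_graph 5 B11).
Proof.
pose p := [:: 0; 1; 0; 2; 1; 3; 1; 3; 3; 2; 2].
have pE (v : 'I_11) : val (inord (nth 0 p v) : 'I_5) = nth 0 p v.
  apply: inordK; have /allP := isT : all (fun a => a < 5) p; apply.
  exact: mem_nth.
split.
  have [|c _] := @coloring_exists 5 B11 (fun v => inord (nth 0 p v)).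
    move=> u v; rewrite B11_nbrsE -val_eqE !pE => uv.
    have /allP tab : all (fun i => all (fun j => nth 0 p i != nth 0 p j)
        (nth [::] B11_nbrs i)) (iota 0 11) by vm_compute.
    have uI : nat_of_ord u \in iota 0 11 by rewrite mem_iota /=.
    exact: (allP (tab _ uI)).
  by apply/card_gt0P; exists c.
move=> c d; rewrite -[connect _ _ _]/(reach c d).
have [c' cc' c'E] := word_reach c; have [d' dd' d'E] := word_reach d.
have /andP[/eqP c'N /hasP[e]] : normal (colors c') by rewrite c'E colors_normal.
have /andP[/eqP d'N _] : normal (colors d') by rewrite d'E colors_normal.
rewrite mem_iota /= => lt_e e_free.
apply: connect_trans cc' _; rewrite reach_sym; apply: connect_trans dd' _.
rewrite reach_sym.
apply: (@reach_same_classes _ _ c' d' (Ordinal lt_e)) => [u v | u].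
  rewrite -!val_eqE /= -!nth_colors.
  by apply: pattern_same_classes; rewrite ?size_colors // c'N d'N.
by apply: contraNneq e_free => cu; apply/colorsP; exists u; rewrite cu.
Qed.

(** * Forbidden subgraphs at a vertex *)

Lemma K4_free_clique (G : sgraph) (a b c d : G) :
    graph_free K4 G -> sedge a b -> sedge a c -> sedge a d ->
  sedge b c -> sedge b d -> ~~ sedge c d.
Proof.
move=> freeG ab ac ad bc bd; apply/negP=> cd; apply: freeG.
have twK4 : twin_free K4.
  move=> x y /setP/(_ x); rewrite !inE sedge_irrefl /= /complete_rel.
  by move/esym/negbFE/eqP.
pose f (i : K4) := nth a [:: a; b; c; d] i.
have fE : edge_preserving f.
  case=> -[|[|[|[|//]]]] i; case=> -[|[|[|[|//]]]] j;
    by rewrite /f /= ?sedge_irrefl // sedge_sym.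
by exists f; split=> //; apply: induced_of_twin_free.
Qed.

Lemma two_K2_free_edges (G : sgraph) (a b c d : G) :
    graph_free two_K2 G -> sedge a b -> sedge c d ->
  [|| sedge a c, sedge a d, sedge b c | sedge b d].
Proof.
move=> freeG ab cd; apply/negPn/negP; rewrite !negb_or => /and4P[ac ad bc bd].
apply: freeG; pose f (i : two_K2) := nth a [:: a; b; c; d] i.
have fE : edge_preserving f.
  case=> -[|[|[|[|//]]]] i; case=> -[|[|[|[|//]]]] j;
    rewrite /f /= ?sedge_irrefl // ?ab ?cd ?(negPf ac) ?(negPf ad) ?(negPf bc)
      ?(negPf bd) // sedge_sym ?ab ?cd ?(negPf ac) ?(negPf ad) ?(negPf bc)
      ?(negPf bd) //.
exists f; split=> //; apply: induced_of_twin_free => //.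
exact: twin_free_edgesP.
Qed.

(** * The traces of vertices on a copy of B11 *)

(** Traces are words of eleven booleans, indexed like the vertices of B11. *)
Definition row (l : seq nat) : seq bool := [seq j \in l | j <- iota 0 11].

Definition traces : seq (seq bool) := [seq row l | l <- [::] :: B11_nbrs].

Definition wedges (p : nat -> nat * nat -> bool) : seq (nat * (nat * nat)) :=
  [seq we <- [seq (w, e) | w <- iota 0 11, e <- B11_edges] | p we.1 we.2].

(** A vertex adjacent to all of [w, x, y] completes an induced K4. *)
Definition triangles : seq (nat * (nat * nat)) := Eval vm_compute in
  wedges (fun w e =>
    (e.1 \in nth [::] B11_nbrs w) && (e.2 \in nth [::] B11_nbrs w)).

(** A vertex adjacent to [w] but to neither [x] nor [y] forms with [w] an edge
    that induces 2K2 together with the edge from [x] to [y]. *)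
Definition far_edges : seq (nat * (nat * nat)) := Eval vm_compute in
  wedges (fun w e => [&& w != e.1, w != e.2, e.1 \notin nth [::] B11_nbrs w
                       & e.2 \notin nth [::] B11_nbrs w]).

(** The four traces that only B10 excludes.  They are the neighborhoods of
    [b], [f], [c1], [x] with [x], [c1], [f], [b] added to them.  The second list
    places the vertices of B10 in their order [c1, ..., c5, f, a, g, y, r] on
    the vertices of B11, 11 standing for the vertex that has the trace. *)
Definition B10_copies : seq (seq bool * seq nat) :=
  [:: (row [:: 1; 2; 4; 6; 7; 8], [:: 1; 0; 4; 3; 2; 7; 8; 5; 11; 10]);
      (row [:: 0; 1; 2; 3; 4; 10], [:: 1; 8; 4; 7; 2; 3; 0; 9; 11; 6]);
      (row [:: 1; 4; 5; 6; 7; 10], [:: 1; 8; 4; 7; 2; 3; 11; 9; 5; 6]);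
      (row [:: 1; 3; 4; 6; 9; 10], [:: 1; 0; 4; 3; 2; 7; 11; 5; 9; 10])].

Lemma triangles_tab :
  all (fun t => let: (w, (x, y)) := t in
    [&& w < 11, x < 11 & y < 11] &&
    [&& erel B11_edges w x, erel B11_edges w y
      & erel B11_edges x y]) triangles.
Proof. by vm_compute. Qed.

Lemma far_edges_tab :
  all (fun t => let: (w, (x, y)) := t in
    [&& w < 11, x < 11 & y < 11] &&
    [&& ~~ erel B11_edges w x, ~~ erel B11_edges w y
      & erel B11_edges x y]) far_edges.
Proof. by vm_compute. Qed.

(** Adjacency in B11 extended by a vertex 11 of trace [m]; a trace has length 11,
    so that [nth] defaults to [false] at the pair of 11 with itself. *)
Definition xrel (m : seq bool) (i j : nat) : bool :=
  if i < 11 then if j < 11 then j \in nth [::] B11_nbrs i else nth false m i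
  else nth false m j.

Lemma B10_copies_tab :
  all (fun mp => all (fun i => all (fun j =>
      xrel mp.1 (nth 0 mp.2 i) (nth 0 mp.2 j) == erel B10_edges i j)
    (iota 0 10)) (iota 0 10)) B10_copies.
Proof. by vm_compute. Qed.

Lemma traces_complete :
  all_words [:: false; true] predT 11 [::] (fun m =>
    [|| m \in traces,
        has (fun t => let: (w, (x, y)) := t in
          [&& nth false m w, nth false m x & nth false m y]) triangles,
        has (fun t => let: (w, (x, y)) := t in
          [&& nth false m w, ~~ nth false m x & ~~ nth false m y]) far_edges
      | m \in unzip1 B10_copies]).
Proof. by vm_compute. Qed.

(** Setting place [i] to [false] in both words compares them away from [i]: two
    admissible traces never differ in exactly one place. *)
Lemma traces_separated :
  all (fun t => all (fun u => all (fun i =>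
      (set_nth false t i false == set_nth false u i false) ==> (t == u))
    (iota 0 11)) traces) traces.
Proof. by vm_compute. Qed.

Section Traces.

Variable G : sgraph.
Hypotheses (G_reduced : reduced G) (G_2K2_free : graph_free two_K2 G)
  (G_K4_free : graph_free K4 G) (G_B10_free : graph_free B10 G).

Definition trace (f : B11 -> G) (v : G) : seq bool :=
  [seq sedge v (f i) | i <- enum 'I_11].

Lemma size_trace f v : size (trace f v) = 11.
Proof. by rewrite size_map size_enum_ord. Qed.

Lemma nth_trace f v (i : 'I_11) : nth false (trace f v) i = sedge v (f i).
Proof. by rewrite (nth_map i) ?size_enum_ord // nth_ord_enum. Qed.

Lemma trace_in_traces f v : edge_preserving f -> trace f v \in traces.
Proof.
move=> fE.
have bools : {subset trace f v <= [:: false; true]} by case.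
have := traces_complete; rewrite -(size_trace f v).
move=> /all_wordsP/(_ bools (fun=> isT))/or4P[] // => [/hasP[]|/hasP[]|/mapP[]].
- case=> w [x y] /(allP triangles_tab).
  case/andP=> /and3P[lw lx ly] /and3P[wx wy xy] /and3P[].
  rewrite -[w]/(nat_of_ord (Ordinal lw)) -[x]/(nat_of_ord (Ordinal lx)).
  rewrite -[y]/(nat_of_ord (Ordinal ly)) !nth_trace => vw vx vy.
  have [fwx fwy] : sedge (f (Ordinal lw)) (f (Ordinal lx)) /\
                   sedge (f (Ordinal lw)) (f (Ordinal ly)) by rewrite !fE.
  have := K4_free_clique G_K4_free vw vx vy fwx fwy.
  by rewrite fE => /negP[].
- case=> w [x y] /(allP far_edges_tab).
  case/andP=> /and3P[lw lx ly] /and3P[wx wy xy] /and3P[].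
  rewrite -[w]/(nat_of_ord (Ordinal lw)) -[x]/(nat_of_ord (Ordinal lx)).
  rewrite -[y]/(nat_of_ord (Ordinal ly)) !nth_trace => vw vx vy.
  have fxy : sedge (f (Ordinal lx)) (f (Ordinal ly)) by rewrite fE.
  have := two_K2_free_edges G_2K2_free vw fxy.
  rewrite (negPf vx) (negPf vy) !fE /=.
  by case/orP=> E; [case: (negP wx E) | case: (negP wy E)].
- case=> m p mp /= mE; case: G_B10_free.
  have /allP tab := allP B10_copies_tab _ mp.
  pose place (i : nat) : G := if insub i is Some x then f x else v.
  have placeE i j : sedge (place i) (place j) = xrel m i j.
    rewrite /place /xrel -mE.
    case: insubP => [x -> xi | /negPf->]; case: insubP => [y lt_j yj | nj].
    + by rewrite lt_j fE B11_nbrsE xi yj.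
    + by rewrite (negPf nj) -xi nth_trace sedge_sym.
    + by rewrite -yj nth_trace.
    + by rewrite sedge_irrefl nth_default // size_trace leqNgt.
  have gE : edge_preserving (fun i : B10 => place (nth 0 p i)).
    move=> i j; rewrite placeE.
    have ordI (z : 'I_10) : nat_of_ord z \in iota 0 10 by rewrite mem_iota /=.
    exact: (eqP (allP (tab _ (ordI i)) _ (ordI j))).
  exists (fun i : B10 => place (nth 0 p i)); split=> //.
  apply: induced_of_twin_free gE; apply: twin_free_edgesP; by vm_compute.
Qed.

(** Replacing the vertex [i] of the copy by [v] yields another copy [f'].  The
    traces of any [w] on both copies are admissible and agree away from [i], so
    they are equal by [traces_separated]: [v] and [f i] have the same neighbors. *)
Lemma copy_vertex (f : B11 -> G) i v :
  edge_preserving f -> trace f v = trace f (f i) -> v = f i.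
Proof.
move=> fE tr_v; apply: (reduced_twin_free G_reduced); apply/setP=> w.
have vE j : sedge v (f j) = sedge (f i) (f j) by rewrite -!nth_trace tr_v.
pose f' j := if j == i then v else f j.
have f'E : edge_preserving f'.
  move=> x y; rewrite /f'; have [->|_] := eqVneq x i; have [->|_] := eqVneq y i.
  - by rewrite !sedge_irrefl.
  - by rewrite vE fE.
  - by rewrite sedge_sym vE fE sedge_sym.
  - exact: fE.
have agree :
    set_nth false (trace f w) i false = set_nth false (trace f' w) i false.
  apply: (@eq_from_nth _ false); first by rewrite !size_set_nth !size_trace.
  move=> j; rewrite size_set_nth size_trace (maxn_idPr _) // => lt_j.
  rewrite !nth_set_nth /= -[j]/(nat_of_ord (Ordinal lt_j)) !nth_trace.
  by rewrite /f' -val_eqE /=; case: ifP.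
have iI : nat_of_ord i \in iota 0 11 by rewrite mem_iota /=.
have /allP/(_ _ (trace_in_traces w f'E))/allP/(_ _ iI) :=
  allP traces_separated _ (trace_in_traces w fE).
rewrite agree eqxx => /eqP/(congr1 (fun t => nth false t i)).
by rewrite !nth_trace /f' eqxx !inE sedge_sym [RHS]sedge_sym.
Qed.

Lemma trace_copy (f : B11 -> G) (i : 'I_11) : edge_preserving f ->
  trace f (f i) = row (nth [::] B11_nbrs i).
Proof.
move=> fE; apply: (@eq_from_nth _ false); first by rewrite size_trace.
move=> j; rewrite size_trace => lt_j.
rewrite (nth_map 0) ?size_iota // nth_iota //.
by rewrite -[j in LHS]/(nat_of_ord (Ordinal lt_j)) nth_trace fE B11_nbrsE.
Qed.

(** A vertex of empty trace is isolated, so its neighborhood is contained in that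
    of any vertex and [G] is not reduced. *)
Lemma copy_onto (f : B11 -> G) v : edge_preserving f -> exists i, f i = v.
Proof.
move=> fE.
have onto u : trace f u != row [::] -> exists i, f i = u.
  have /mapP[l] := trace_in_traces u fE; rewrite in_cons.
  case/predU1P=> [-> -> /eqP // | /(nthP [::])[i lt_i <-] uE _].
  exists (Ordinal (lt_i : i < 11)); apply/esym/copy_vertex => //.
  by rewrite trace_copy.
have [v0 | /onto //] := eqVneq (trace f v) (row [::]).
have v_far i : ~~ sedge v (f i).
  by rewrite -nth_trace v0 (nth_map 0) ?size_iota.
(* A neighbor of [v] in the copy would contradict [v0]; a neighbor with empty
   trace would form an induced 2K2 with the edge from [c1] to [c2]. *)
have nb_v : nbhd v = set0.
  apply/setP=> w; rewrite !inE; apply/negP=> vw.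
  have [w0 | /onto[i fi]] := eqVneq (trace f w) (row [::]); last first.
    by have := v_far i; rewrite fi vw.
  have w_far i : ~~ sedge w (f i).
    by rewrite -nth_trace w0 (nth_map 0) ?size_iota.
  have fxy : sedge (f (inord 0)) (f (inord 1)).
    by rewrite fE B11_nbrsE !inordK.
  have := two_K2_free_edges G_2K2_free vw fxy.
  by rewrite !(negPf (v_far _)) !(negPf (w_far _)).
exists (inord 0); apply/esym/reduced_sub => //.
by rewrite nb_v sub0set.
Qed.

End Traces.

(** * Transport along an isomorphism *)

Lemma reconf_iso (k : nat) (F G : sgraph) (f : F -> G) :
    edge_preserving f -> bijective f ->
  connected_graph (reconf_graph k F) -> connected_graph (reconf_graph k G).
Proof.
move=> fE [g fK gK] [].
have gE : edge_preserving g by move=> x y; rewrite -fE !gK.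
have pull (c : coloring k G) :
    exists d : coloring k F, forall u, val d u = val c (f u).
  by apply: coloring_exists => u v uv; apply: coloringP; rewrite fE.
have push (c : coloring k F) :
    exists d : coloring k G, forall u, val d u = val c (g u).
  by apply: coloring_exists => u v uv; apply: coloringP; rewrite gE.
case/card_gt0P=> c0 _ conn; split.
  by have [d _] := push c0; apply/card_gt0P; exists d.
move=> c d; have [c' c'E] := pull c; have [d' d'E] := pull d.
case/connectP: (conn c' d') => p.
elim: p c c' c'E => [|e' p IHp] c c' c'E /=.
  move=> _ d'c'; suff -> : c = d by apply: connect0.
  apply/val_inj/ffunP=> u; rewrite -[u]gK -c'E -d'E.
  by rewrite d'c'.
case/andP=> c'e' /IHp{}IHp {}/IHp IHp.
have [e eE] := push e'.
have step : connect (@sedge (reconf_graph k G)) c e.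
  apply: connect1; move: c'e'; rewrite /= /reconf_adj => /eqP <-.
  apply/eqP; rewrite -(card_imset _ (can_inj fK)); apply: eq_card => u.
  rewrite -[u]gK mem_imset ?inE; last exact: can_inj fK.
  by rewrite eE fK c'E.
by apply: connect_trans step (IHp e _) => u; rewrite eE fK.
Qed.

Theorem mainTheorem4 (G : sgraph)
  (G_reduced : reduced G)
  (G_2K2_free : graph_free two_K2 G)
  (G_K4_free : graph_free K4 G)
  (G_B10_free : graph_free B10 G)
  (G_B11 : contains_induced B11 G) :
  connected_graph (reconf_graph 5 G).
Proof.
have [f [f_inj fE]] := G_B11.
apply: (reconf_iso fE); last exact: reconf_B11_connected.
apply: inj_card_bij => //; rewrite -(card_imset _ f_inj).
apply/subset_leq_card/subsetP=> v _.
have [i <-] := copy_onto G_reduced G_2K2_free G_K4_free G_B10_free v fE.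
exact: imset_f.
Qed.
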